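(* Let $a,b,m\ge 0$ be integers and let $\ell\in\mathbb{Z}$. The following identities hold. I. If $0<\ell<a-b$, then $$G_{a,b}^{\ge 2m+1,\ell}(t,q)=G_{a,b}^{\ge 2m,\ell}(t,q)=\sum_{n\ge0}t^n q^{n^2+m(m+\ell+1)}\begin{bmatrix}a\\ n-m\end{bmatrix}_q\begin{bmatrix}b\\ n+m\end{bmatrix}_q.$$ II. If $0>\ell>a-b$, then $$G_{a,b}^{\ge 2m+1,\ell}(t,q)=G_{a,b}^{\ge 2m,\ell}(t,q)=\sum_{n\ge0}t^n q^{n^2+m(m-\ell-1)}\begin{bmatrix}a\\ n+m\end{bmatrix}_q\begin{bmatrix}b\\ n-m\end{bmatrix}_q.$$ III. If $0>\ell<a-b$ (that is, $\ell<0$ and $\ell<a-b$), then $$G_{a,b}^{\ge 2m+2,\ell}(t,q)=G_{a,b}^{\ge 2m+1,\ell}(t,q)=\sum_{n\ge0}t^n q^{n^2+(m+1)(m-\ell)}\begin{bmatrix}a-\ell-1\\ n-m-1\end{bmatrix}_q\begin{bmatrix}b+\ell+1\\ n+m+1\end{bmatrix}_q.$$ IV. If $0<\ell>a-b$ (that is, $\ell>0$ and $\ell>a-b$), then $$G_{a,b}^{\ge 2m+2,\ell}(t,q)=G_{a,b}^{\ge 2m+1,\ell}(t,q)=\sum_{n\ge0}t^n q^{n^2+m(m+\ell+1)}\begin{bmatrix}a-\ell-1\\ n+m\end{bmatrix}_q\begin{bmatrix}b+\ell+1\\ n-m\end{bmatrix}_q.$$ V. If $0=\ell<a-b$, then $$G_{a,b}^{\ge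 2m,\ell}(t,q)=\sum_{n\ge0}t^n q^{n^2+m(m+1)}\begin{bmatrix}a\\ n-m\end{bmatrix}_q\begin{bmatrix}b\\ n+m\end{bmatrix}_q,$$ $$G_{a,b}^{\ge 2m+1,\ell}(t,q)=\sum_{n\ge0}t^n q^{n^2+m(m+1)}\begin{bmatrix}a-1\\ n-m-1\end{bmatrix}_q\begin{bmatrix}b+1\\ n+m+1\end{bmatrix}_q.$$ VI. If $0=\ell>a-b$, then $$G_{a,b}^{\ge 2m,\ell}(t,q)=\sum_{n\ge0}t^n q^{n^2+m(m-1)}\begin{bmatrix}a\\ n+m\end{bmatrix}_q\begin{bmatrix}b\\ n-m\end{bmatrix}_q,$$ $$G_{a,b}^{\ge 2m+1,\ell}(t,q)=\sum_{n\ge0}t^n q^{n^2+m(m+1)}\begin{bmatrix}a-1\\ n+m\end{bmatrix}_q\begin{bmatrix}b+1\\ n-m\end{bmatrix}_q.$$ VII. If $0<\ell=a-b$, then $$G_{a,b}^{\ge 2m,\ell}(t,q)=\sum_{n\ge0}t^n q^{n^2+m(m+\ell+1)}\begin{bmatrix}a\\ n-m\end{bmatrix}_q\begin{bmatrix}b\\ n+m\end{bmatrix}_q,$$ $$G_{a,b}^{\ge 2m+1,\ell}(t,q)=\sum_{n\ge0}t^n q^{n^2+m(m+\ell+1)}\begin{bmatrix}a+1\\ n-m\end{bmatrix}_q\begin{bmatrix}b-1\\ n+m\end{bmatrix}_q.$$ VIII. If $0>\ell=a-b$, then $$G_{a,b}^{\ge 2m,\ell}(t,q)=\sum_{n\ge0}t^n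 q^{n^2+m(m-\ell-1)}\begin{bmatrix}a\\ n+m\end{bmatrix}_q\begin{bmatrix}b\\ n-m\end{bmatrix}_q,$$ $$G_{a,b}^{\ge 2m+1,\ell}(t,q)=\sum_{n\ge0}t^n q^{n^2+(m+1)(m-\ell)}\begin{bmatrix}a+1\\ n+m+1\end{bmatrix}_q\begin{bmatrix}b-1\\ n-m-1\end{bmatrix}_q.$$ IX. If $0=\ell=a-b$, then $$G_{a,b}^{\ge 2m,\ell}(t,q)=\sum_{n\ge0}t^n q^{n^2+m(m+1)}\,\frac{1-q^{a-2m}}{1-q^a}\begin{bmatrix}a\\ n+m\end{bmatrix}_q\begin{bmatrix}a\\ n-m\end{bmatrix}_q,$$ $$G_{a,b}^{\ge 2m+1,\ell}(t,q)=\sum_{n\ge0}t^n q^{n^2+m(m+1)}\,\frac{1-q^{a+2(m+1)}}{1-q^a}\begin{bmatrix}a\\ n+m+1\end{bmatrix}_q\begin{bmatrix}a\\ n-m-1\end{bmatrix}_q.$$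
   Context: For integers $M,N$, the $q$-binomial coefficient is $$\begin{bmatrix}M\\ N\end{bmatrix}_q=\frac{(1-q^M)(1-q^{M-1})\cdots(1-q^{M-N+1})}{(1-q^N)(1-q^{N-1})\cdots(1-q)}$$ if $0\le N\le M$, and $0$ otherwise. For integers $a,b\ge0$, $\mathcal G_{a,b}$ is the set of lattice paths starting at the origin with $a$ steps $U=(1,1)$ and $b$ steps $D=(1,-1)$, in any order. The vertices of a path are numbered $0,1,2,\dots$ along the path, starting with $0$ at the origin. A descent (valley) of a path is a vertex preceded by a $D$ and followed by a $U$. $\mathrm{des}(P)$ is the number of descents of $P$, and $\mathrm{maj}(P)$ is the sum of the positions (vertex numbers) of the descents of $P$. For $\ell\in\mathbb Z$, a vertex of the path lying on the line $y=\ell$ is a crossing of that line if it is either preceded and followed by a $D$, or preceded and followed by a $U$ (so endpoints of the path are never crossings). For an integer $r\ge0$, $\mathcal G_{a,b}^{\ge r,\ell}$ is the set of paths in $\mathcal G_{a,b}$ that cross the line $y=\ell$ at least $r$ times, and $$G_{a,b}^{\ge r,\ell}(t,q)=\sum_{P\in\mathcal G_{a,b}^{\ge r,\ell}} t^{\mathrm{des}(P)} q^{\mathrm{maj}(P)}.$$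
   Formalization: In case IX with a=b=0 the printed factor has denominator 1-q^0=0; there the factor (1-q^{a-2m})/(1-q^a) is read as 1 when m=0, and in the other such instances the vanishing q-binomials make the term 0. For a>0 the factor is as printed. *)

(* Defs.v *)
From mathcomp Require Import all_boot all_order all_algebra.
From mathcomp Require Import classical_sets fsbigop.

Set Implicit Arguments.
Unset Strict Implicit.
Unset Printing Implicit Defensive.

Import Order.TTheory GRing.Theory Num.Theory.
Local Open Scope ring_scope.

(* The identities live in Q(q)[t], with q and t indeterminates. *)
Definition Qq := {fraction {poly rat}}.
Definition q : Qq := tofrac ('X : {poly rat}).
Definition t : {poly Qq} := 'X.

Definition qbinom (M N : int) : Qq :=
  if 0 <= N <= M then
    (\prod_(0 <= i < `|N|%N) (1 - q ^ (M - i%:Z)))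
      / (\prod_(0 <= i < `|N|%N) (1 - q ^ (N - i%:Z)))
  else 0.

(* (1 - q^k) / (1 - q^a), where the case k = a is 1; this only differs from
   the plain quotient at k = a = 0, where the latter is 0/0 and the division
   of the field would return 0. *)
Definition qratio (k a : int) : Qq :=
  if k == a then 1 else (1 - q ^ k) / (1 - q ^ a).

(* A path is the sequence of its steps, true being U = (1,1) and false being
   D = (1,-1). Vertex i (0 <= i <= size P) has abscissa i; for 0 < i < size P
   it is preceded by the step of index i - 1 and followed by that of index i. *)
Definition paths (a b : nat) : {set (a + b).-tuple bool} :=
  [set P : (a + b).-tuple bool |
    (count_mem true P == a) && (count_mem false P == b)].

Definition height (P : seq bool) (i : nat) : int :=
  (count_mem true (take i P))%:Z - (count_mem false (take i P))%:Z.

Definition inner (P : seq bool) (i : nat) : bool := (0 < i < size P)%N.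

Definition step_before (P : seq bool) (i : nat) : bool := nth false P i.-1.
Definition step_after (P : seq bool) (i : nat) : bool := nth false P i.

Definition descents (P : seq bool) : seq nat :=
  [seq i <- iota 0 (size P).+1 |
    [&& inner P i, step_before P i == false & step_after P i == true]].

Definition des (P : seq bool) : nat := size (descents P).
Definition maj (P : seq bool) : nat := \sum_(i <- descents P) i.

Definition crossings (l : int) (P : seq bool) : seq nat :=
  [seq i <- iota 0 (size P).+1 |
    [&& inner P i, height P i == l & step_before P i == step_after P i]].

Definition paths_ge (a b r : nat) (l : int) : {set (a + b).-tuple bool} :=
  [set P in paths a b | (r <= size (crossings l P))%N].

Definition G (a b r : nat) (l : int) : {poly Qq} :=
  \sum_(P in paths_ge a b r l) q ^+ maj P *: t ^+ des P.

(* Main.v *)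
(* Away from the line y = l, appending the last step of a path gives, for the
   generating function X_{a,b} of the paths to (a+b, a-b),
     X_{a,b} - X_{a-1,b} - X_{a,b-1} + X_{a-1,b-1} = t q^(a+b-1) X_{a-1,b-1},
   and by the q-Pascal rule every series
     sum_n t^n q^(n^2) [A, n-s] [B, n+s],   A + B = a + b,
   solves this recurrence. So for each r there is one closed formula above the
   line ([above]) and another below it ([below]); what has to be checked is how
   they are glued along the line. In a step across the line, the formulas for
   r and r-1 crossings must satisfy, for all r
   (with r-1 read as 0 when r = 0),
     above (r-1) = below r                       at height l+1 ([above_pred]),
     (below (r-1) - above r)_{a,b} = (same)_{a,b-1}   at height l
                                                 ([below_pred_sub_above]),
   the first being the symmetry of the two binomials and the second one more
   application of q-Pascal. At an endpoint on the line the result is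
   below_{a,b} - below_{a,b-1} + above_{a,b-1}. *)

Require Import Defs.
From mathcomp Require Import all_boot all_order all_algebra.
From mathcomp Require Import classical_sets fsbigop.
From mathcomp Require Import zify ring.

Set Implicit Arguments.
Unset Strict Implicit.
Unset Printing Implicit Defensive.
Import Order.TTheory GRing.Theory Num.Theory.
Local Open Scope ring_scope.

(* An abstract field stands for Q(q), whose concrete construction [ring] and
   [field] would try to evaluate. *)
Section QAnalogue.
Variables (F : fieldType) (x : F).
Hypothesis x_neq0 : x != 0.
Hypothesis x_expz_eq1 : forall k : int, (x ^ k == 1) = (k == 0).

(** * Gaussian binomials with integer entries and the q-Pascal rule *)

Definition gauss (M N : int) : F :=
  if 0 <= N <= M then
    (\prod_(0 <= i < `|N|%N) (1 - x ^ (M - i%:Z)))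
      / (\prod_(0 <= i < `|N|%N) (1 - x ^ (N - i%:Z)))
  else 0.

Lemma subr1_expz_neq0 (k : int) : k != 0 -> 1 - x ^ k != 0.
Proof. by move=> k0; rewrite subr_eq0 eq_sym x_expz_eq1. Qed.

Lemma expzD (i j : int) : x ^ (i + j) = x ^ i * x ^ j.
Proof. exact: expfzDr. Qed.

Lemma gauss_out (M N : int) : ~~ (0 <= N <= M) -> gauss M N = 0.
Proof. by rewrite /gauss => /negbTE ->. Qed.

Lemma gauss0 (M : int) : 0 <= M -> gauss M 0 = 1.
Proof. by move=> hM; rewrite /gauss lexx hM absz0 !big_geq // divr1. Qed.

Lemma gauss_diag_mul (M N : int) :
  (1 - x ^ N) * gauss M N = (1 - x ^ M) * gauss (M - 1) (N - 1).
Proof.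
have [->|N0] := eqVneq N 0.
  by rewrite expr0z subrr mul0r gauss_out ?mulr0 //; lia.
case: (boolP (0 <= N <= M)) => hN; last first.
  by rewrite !gauss_out ?mulr0 //; lia.
rewrite /gauss hN (_ : 0 <= N - 1 <= M - 1); last by lia.
have -> : `|N|%N = (`|N - 1|%N).+1 by lia.
have prodS (k : int) : \prod_(0 <= i < (`|N - 1|%N).+1) (1 - x ^ (k - i%:Z)) =
    (1 - x ^ k) * \prod_(0 <= i < `|N - 1|%N) (1 - x ^ (k - 1 - i%:Z)).
  rewrite big_nat_recl // subr0; congr (_ * _); apply: eq_bigr => i _.
  by congr (1 - x ^ _); lia.
rewrite !prodS; field.
apply/andP; split; last exact: subr1_expz_neq0.
rewrite prodf_seq_neq0; apply/allP => i; rewrite mem_index_iota => hi.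
by apply/implyP => _; apply: subr1_expz_neq0; lia.
Qed.

Lemma gauss_pred_mul (M N : int) :
  (1 - x ^ (M - N)) * gauss M N = (1 - x ^ M) * gauss (M - 1) N.
Proof.
have [->|NM] := eqVneq M N.
  by rewrite subrr expr0z subrr mul0r gauss_out ?mulr0 //; lia.
case: (boolP (0 <= N <= M)) => hN; last first.
  by rewrite !gauss_out ?mulr0 //; lia.
rewrite /gauss hN (_ : 0 <= N <= M - 1); last by lia.
rewrite !mulrA; congr (_ / _).
transitivity (\prod_(0 <= i < (`|N|%N).+1) (1 - x ^ (M - i%:Z))).
  by rewrite big_nat_recr //= mulrC; congr (_ * (1 - x ^ _)); lia.
rewrite big_nat_recl // subr0; congr (_ * _); apply: eq_bigr => i _.
by congr (1 - x ^ _); lia.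
Qed.

(** Multiply by [1 - x ^ M] and use the two absorption identities. At [M = N = 0] the rule fails:
    the left side is 1, the right side 0. *)
Lemma gauss_pascal (M N : int) : (M != 0) || (N != 0) ->
  gauss M N - gauss (M - 1) N = x ^ (M - N) * gauss (M - 1) (N - 1).
Proof.
have [-> /= N0|M0 _] := eqVneq M 0.
  by rewrite !gauss_out ?mulr0 ?subr0 //; lia.
apply: (mulfI (subr1_expz_neq0 M0)).
rewrite mulrBr -gauss_pred_mul [RHS]mulrCA -gauss_diag_mul.
rewrite -mulrBl mulrA mulrBr mulr1 -expzD subrK; ring.
Qed.

(* The coefficient of t^n in [q^(s(s+l+1)) * sum_n t^n q^(n^2) [a, n-s] [b, n+s]]. *)
Definition direct (l s a b n : int) : F :=
  x ^ (s * (s + l + 1)) * (x ^ (n ^+ 2) * gauss a (n - s) * gauss b (n + s)).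

(** The tops are the step counts of the endpoint reflected in the line y = l + 1, in swapped order;
    on that line they are [b] and [a]. *)
Definition shifted (l s a b n : int) : F :=
  x ^ (s * (s - l - 1))
    * (x ^ (n ^+ 2) * gauss (a - l - 1) (n - s) * gauss (b + l + 1) (n + s)).

(** * The recurrence in the endpoint and the relations along the line *)

Definition kernel_rec (f : int -> int -> int -> F) (a b : int) : Prop :=
  forall n, f a b n - f (a - 1) b n - f a (b - 1) n + f (a - 1) (b - 1) n
            = x ^ (a + b - 1) * f (a - 1) (b - 1) (n - 1).

(** Product of two q-Pascal rules. The hypotheses cover a vanishing top, where q-Pascal can fail:
    the right side is then 0, and the sign of [s] makes one of the two differences on the left
    vanish. *)
Lemma gauss_pair_rec (A B s n : int) :
  (A = 0 -> B != 0 /\ s <= 0) -> (B = 0 -> A != 0 /\ 0 <= s) ->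
  x ^ (n ^+ 2) * (gauss A (n - s) - gauss (A - 1) (n - s))
    * (gauss B (n + s) - gauss (B - 1) (n + s))
  = x ^ (A + B - 1) * (x ^ ((n - 1) ^+ 2) * gauss (A - 1) (n - 1 - s)
                         * gauss (B - 1) (n - 1 + s)).
Proof.
move=> hA hB.
have [A0|A0] := eqVneq A 0.
  have [B0 s0] := hA A0; rewrite A0 [in RHS]gauss_out; last by lia.
  rewrite mulr0 mul0r mulr0.
  have [ns|ns] := eqVneq n s; last first.
    by rewrite !(@gauss_out _ (n - s)) ?subrr ?mulr0 ?mul0r//; lia.
  have [nB|nB] := leP 0 B; last by rewrite !(@gauss_out _ (n + s)) ?subrr ?mulr0//; lia.
  have [s00|s00] := eqVneq s 0; last first.
    by rewrite !(@gauss_out _ (n + s)) ?subrr ?mulr0//; lia.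
  by rewrite (_ : n + s = 0) ?gauss0 ?subrr ?mulr0 //; lia.
have [B0|B0] := eqVneq B 0.
  have [_ s0] := hB B0; rewrite B0 [X in _ = _ * (_ * X)]gauss_out; last by lia.
  rewrite !mulr0.
  have [ns|ns] := eqVneq (n + s) 0; last first.
    by rewrite !(@gauss_out _ (n + s)) ?subrr ?mulr0 //; lia.
  have [nA|nA] := leP 0 A; last first.
    by rewrite !(@gauss_out _ (n - s)) ?subrr ?mulr0 ?mul0r//; lia.
  have [s00|s00] := eqVneq s 0; last first.
    by rewrite !(@gauss_out _ (n - s)) ?subrr ?mulr0 ?mul0r//; lia.
  by rewrite (_ : n - s = 0) ?gauss0 ?subrr ?mulr0 ?mul0r //; lia.
rewrite !gauss_pascal ?A0 ?B0 //.
rewrite (_ : n - s - 1 = n - 1 - s); last by lia.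
rewrite (_ : n + s - 1 = n - 1 + s); last by lia.
(* Both Pascal exponents are absorbed by n^2 - 2n = (n - 1)^2 - 1. *)
transitivity (x ^ (n ^+ 2 + (A - (n - s)) + (B - (n + s))) *
   (gauss (A - 1) (n - 1 - s) * gauss (B - 1) (n - 1 + s))).
  rewrite !expzD; ring.
rewrite (_ : n ^+ 2 + _ + _ = A + B - 1 + (n - 1) ^+ 2) ?expzD; ring.
Qed.

Lemma direct_rec (l s a b : int) : 0 < a -> 0 < b -> kernel_rec (direct l s) a b.
Proof.
move=> ha hb n; rewrite /direct [RHS]mulrCA -gauss_pair_rec; [ring | lia | lia].
Qed.

Lemma shifted_rec (l s a b : int) : 0 < a -> 0 < b ->
  (a = l + 1 -> s <= 0) -> (b = - l - 1 -> 0 <= s) ->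
  kernel_rec (shifted l s) a b.
Proof.
move=> ha hb hal hbl n; rewrite /shifted [RHS]mulrCA.
rewrite (_ : a + b - 1 = (a - l - 1) + (b + l + 1) - 1); last by lia.
rewrite (_ : a - 1 - l - 1 = a - l - 1 - 1); last by lia.
rewrite (_ : b - 1 + l + 1 = b + l + 1 - 1); last by lia.
rewrite -gauss_pair_rec; [ring | lia | lia].
Qed.

Lemma shifted_opp (l s a b n : int) : a - b = l + 1 ->
  shifted l (- s) a b n = direct l s a b n.
Proof.
move=> hl; rewrite /shifted /direct.
rewrite (_ : - s * (- s - l - 1) = s * (s + l + 1)); last by ring.
rewrite (_ : a - l - 1 = b); last by lia.
rewrite (_ : b + l + 1 = a) ?opprK; last by lia.
ring.
Qed.

(** On the line the tops of [shifted] are [b - 1] and [a + 1]. Both differences in [b] reduce by one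
    q-Pascal step to [a, n-s] [b-1, n+s-1], with equal powers of [x]. *)
Lemma shifted_sub_direct (l s a b n : int) : a - b = l -> 0 <= a -> 0 < b ->
  shifted l (1 - s) a b n - direct l s a b n
  = shifted l (1 - s) a (b - 1) n - direct l s a (b - 1) n.
Proof.
move=> hl ha hb.
suff: shifted l (1 - s) a b n - shifted l (1 - s) a (b - 1) n
      = direct l s a b n - direct l s a (b - 1) n.
  by move/eqP; rewrite -subr_eq0 => /eqP e; apply: subr0_eq; rewrite -[RHS]e; ring.
rewrite /shifted /direct.
rewrite (_ : a - l - 1 = b - 1); last by lia.
rewrite (_ : b + l + 1 = a + 1); last by lia.
rewrite (_ : b - 1 + l + 1 = a + 1 - 1); last by lia.
rewrite (_ : n - (1 - s) = n + s - 1); last by lia.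
rewrite -!mulrBr !gauss_pascal; try lia.
rewrite addrK (_ : n + (1 - s) - 1 = n - s); last by lia.
transitivity (x ^ ((1 - s) * (1 - s - l - 1) + n ^+ 2 + (a + 1 - (n + (1 - s))))
   * (gauss a (n - s) * gauss (b - 1) (n + s - 1))).
  by rewrite !expzD; ring.
rewrite (_ : _ + _ + _ = s * (s + l + 1) + n ^+ 2 + (b - (n + s))).
  by rewrite !expzD; ring.
by rewrite -hl; ring.
Qed.

Lemma direct_out (l s a b n : int) :
  ~~ ((0 <= n - s <= a) && (0 <= n + s <= b)) -> direct l s a b n = 0.
Proof.
rewrite negb_and => /orP[] h; first by rewrite /direct (gauss_out h) mulr0 mul0r mulr0.
by rewrite /direct (gauss_out h) !mulr0.
Qed.

Lemma shifted_out (l s a b n : int) :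
  ~~ ((0 <= n - s <= a - l - 1) && (0 <= n + s <= b + l + 1)) ->
  shifted l s a b n = 0.
Proof.
rewrite negb_and => /orP[] h; first by rewrite /shifted (gauss_out h) mulr0 mul0r mulr0.
by rewrite /shifted (gauss_out h) !mulr0.
Qed.

Lemma direct0 (l a b : int) : 0 <= a -> 0 <= b -> direct l 0 a b 0 = 1.
Proof.
by move=> ha hb; rewrite /direct ?subr0 ?addr0 mul0r expr0n !gauss0 // expr0z !mulr1.
Qed.

(** The index follows the parity of the number of crossings. It is odd from below the line to above
    it, so 2m and 2m+1 give the same bound; it is even from above to above, so 2m+1 and 2m+2 do. For
    [l = 0] the path starts on the line and both parities occur. At [r = 0] the series is that of
    all paths. *)
Definition above (l : int) (r : nat) : int -> int -> int -> F :=
  if 0 < l then direct l r./2%:Z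
  else if l < 0 then
    if r == 0%N then direct l 0 else shifted l (uphalf r)%:Z
  else if odd r then shifted l (r./2%:Z + 1) else direct l r./2%:Z.

(** Here the parity is even for [0 < l] and odd for [l < 0]. The negative index exchanges the lower
    entries of the two binomials. *)
Definition below (l : int) (r : nat) : int -> int -> int -> F :=
  if 0 < l then
    if r == 0%N then direct l 0 else shifted l (- (r.-1)./2%:Z)
  else if l < 0 then direct l (- r./2%:Z)
  else if odd r then shifted l (- r./2%:Z) else direct l (- r./2%:Z).

Lemma above_rec (l : int) (r : nat) (a b : int) :
  0 < a -> 0 < b -> l < a - b -> kernel_rec (above l r) a b.
Proof.
move=> ha hb hl; rewrite /above.
case: ltP => l0; first exact: direct_rec.
case: ltP => l0'.
  by case: ifP => _; [exact: direct_rec | apply: shifted_rec => //; lia].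
by case: ifP => _; [apply: shifted_rec => //; lia | exact: direct_rec].
Qed.

Lemma below_rec (l : int) (r : nat) (a b : int) :
  0 < a -> 0 < b -> a - b <= l -> kernel_rec (below l r) a b.
Proof.
move=> ha hb hl; rewrite /below.
case: ltP => l0.
  by case: ifP => _; [exact: direct_rec | apply: shifted_rec => //; lia].
case: ltP => l0'; first exact: direct_rec.
by case: ifP => _; [apply: shifted_rec => //; lia | exact: direct_rec].
Qed.

Lemma above_pred (l : int) (r : nat) (a b n : int) : a - b = l + 1 ->
  above l r.-1 a b n = below l r a b n.
Proof.
move=> hl; rewrite /above /below.
have [m [->|[->|->]]] : exists m, r = 0%N \/ r = m.*2.+1 \/ r = m.*2.+2.
  by exists (r.-1)./2; lia.
- by rewrite /= oppr0; case: ltP => // l0; case: ltP.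
- rewrite /= ?odd_double ?doubleK ?uphalf_double /=.
  case: ltP => // l0; first by rewrite shifted_opp.
  case: ltP => // l0'; last by rewrite shifted_opp.
  case: m => [|m]; first by rewrite oppr0.
  by rewrite -shifted_opp // opprK.
rewrite /= ?odd_double ?doubleK ?uphalf_double /= ?odd_double ?doubleK /=.
case: ltP => // l0; first by rewrite shifted_opp.
case: ltP => // l0'; rewrite -shifted_opp // opprK //.
by congr shifted; lia.
Qed.

Lemma below_pred_sub_above (l : int) (r : nat) (a b n : int) :
  a - b = l -> 0 <= a -> 0 < b ->
  below l r.-1 a b n - above l r a b n
  = below l r.-1 a (b - 1) n - above l r a (b - 1) n.
Proof.
move=> hl ha hb; rewrite /above /below.
(* Which of the two formulas is the shifted one depends on the sign of [l] and, for [l = 0], on the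
   parity of [r]. *)
have flip s f g : (forall u v w, f u v w = shifted l (1 - s) u v w) ->
    (forall u v w, g u v w = direct l s u v w) ->
    f a b n - g a b n = f a (b - 1) n - g a (b - 1) n.
  by move=> hf hg; rewrite !hf !hg; exact: shifted_sub_direct.
have flipN s f g : (forall u v w, f u v w = shifted l (1 - s) u v w) ->
    (forall u v w, g u v w = direct l s u v w) ->
    g a b n - f a b n = g a (b - 1) n - f a (b - 1) n.
  by move=> hf hg; rewrite -opprB (flip s f g) // opprB.
have [m [->|[->|->]]] : exists m, r = 0%N \/ r = m.*2.+1 \/ r = m.*2.+2.
  by exists (r.-1)./2; lia.
- by rewrite /= oppr0; case: ltP => // l0; [|case: ltP => // l0']; rewrite !subrr.
- rewrite /= ?odd_double ?doubleK ?uphalf_double /=.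
  case: ltP => // l0.
    (* For [r = 1] both formulas are the series of all paths. *)
    case: m => [|m]; first by rewrite !subrr.
    apply: (flip m.+1%:Z) => // u v w; congr shifted; lia.
  case: ltP => // l0'; apply: (flipN (- m%:Z)) => // u v w; congr shifted; lia.
rewrite /= ?odd_double ?doubleK ?uphalf_double /= ?odd_double ?doubleK /=.
case: ltP => // l0; first by apply: (flip m.+1%:Z) => // u v w; congr shifted; lia.
case: ltP => // l0'; first by apply: (flipN (- m%:Z)) => // u v w; congr shifted; lia.
by apply: (flip m.+1%:Z) => // u v w; congr shifted; lia.
Qed.

(** * Boundary values; b = -1 arises as b - 1 at b = 0 *)

Lemma above_neg1 (l : int) (r : nat) (a n : int) : 0 <= a -> l <= a ->
  above l r a (- 1) n = 0.
Proof.
move=> ha hl; rewrite /above; case: ltP => l0; first by apply: direct_out; lia.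
case: ltP => l0'; case: ifP => r0; try (apply: direct_out; lia);
  by apply: shifted_out; lia.
Qed.

Lemma below_neg1 (l : int) (r : nat) (a n : int) : 0 <= a -> a <= l ->
  below l r a (- 1) n = 0.
Proof.
move=> ha hl; rewrite /below; case: ltP => l0.
  by case: ifP => r0; [apply: direct_out; lia | apply: shifted_out; lia].
case: ltP => l0'; first by apply: direct_out; lia.
by case: ifP => r0; [apply: shifted_out; lia | apply: direct_out; lia].
Qed.

Lemma direct_b0 (l a n : int) : 0 <= a -> direct l 0 a 0 n = (n == 0)%:R.
Proof.
move=> ha; have [->|n0] := eqVneq n 0; first by rewrite direct0.
by rewrite direct_out //; lia.
Qed.

(** The only path is a run of up steps: it has no descent and, as [l < a], crosses the line once
    exactly when [0 < l]. *)
Lemma above_b0 (l : int) (r : nat) (a n : int) : 0 <= a -> l < a ->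
  above l r a 0 n = ((n == 0) && (r <= (0 < l)%R)%N)%:R.
Proof.
move=> ha hl; rewrite /above; case: ltP => l0.
  case: (ltnP 1 r) => r1 /=; first by rewrite andbF direct_out //; lia.
  by rewrite (_ : r./2 = 0%N) ?direct_b0 ?andbT //; lia.
rewrite leqn0; case: ltP => l0'; case: ifP => r0.
- by rewrite direct_b0 // andbT.
- by rewrite andbF shifted_out //; lia.
- by case: r r0 => // r _; rewrite andbF shifted_out //; lia.
have [->|r1] := eqVneq r 0%N; first by rewrite andbT; exact: direct_b0.
by rewrite andbF direct_out //; lia.
Qed.

Lemma below_b0 (l : int) (r : nat) (a n : int) : 0 <= a -> a <= l ->
  below l r a 0 n = ((n == 0) && (r == 0%N))%:R.
Proof.
move=> ha hl; rewrite /below; case: ltP => l0.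
  case: ifP => r0; first by rewrite direct_b0 // andbT.
  by rewrite andbF shifted_out //; lia.
rewrite ltNge (le_trans ha hl) /=; case: ifP => r0.
  by case: r r0 => // r _; rewrite andbF shifted_out //; lia.
have [->|r1] := eqVneq r 0%N; first by rewrite andbT oppr0; exact: direct_b0.
by rewrite andbF direct_out //; lia.
Qed.

Lemma direct_a0 (l b n : int) : 0 <= b -> direct l 0 0 b n = (n == 0)%:R.
Proof.
move=> hb; have [->|n0] := eqVneq n 0; first by rewrite direct0.
by rewrite direct_out //; lia.
Qed.

(** Without up steps no nonempty path ends in one. The series of the paths ending in an up step is a
    difference in [b], which must vanish here. *)
Lemma above_a0 (l : int) (r : nat) (b n : int) : 0 < b -> l < - b ->
  above l r 0 b n = above l r 0 (b - 1) n.
Proof.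
move=> hb hl; rewrite /above ltNge (_ : l <= 0) /=; last by lia.
rewrite (_ : l < 0); last by lia.
case: ifP => r0; first by rewrite !direct_a0 //; lia.
by rewrite !shifted_out //; lia.
Qed.

Lemma below_a0 (l : int) (r : nat) (b n : int) : 0 < b -> - b <= l ->
  below l r 0 b n = below l r 0 (b - 1) n.
Proof.
move=> hb hl; rewrite /below; case: ltP => l0.
  case: ifP => r0; first by rewrite !direct_a0 //; lia.
  by rewrite !shifted_out //; lia.
have dir : direct l (- r./2%:Z) 0 b n = direct l (- r./2%:Z) 0 (b - 1) n.
  have [->|r0] := eqVneq r./2 0%N; first by rewrite oppr0 !direct_a0 //; lia.
  by rewrite !direct_out //; lia.
case: ltP => l0' //; case: ifP => r0 //.
by rewrite !shifted_out //; lia.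
Qed.

End QAnalogue.

(** * Descents and crossings when a step is appended *)

Lemma filter_inner_rcons (R : seq bool -> nat -> bool) (s : seq bool) (c : bool) :
  (forall i, (i < size s)%N -> R (rcons s c) i = R s i) ->
  [seq i <- iota 0 (size (rcons s c)).+1 | inner (rcons s c) i && R (rcons s c) i]
  = [seq i <- iota 0 (size s).+1 | inner s i && R s i]
    ++ (if (0 < size s)%N && R (rcons s c) (size s) then [:: size s] else [::]).
Proof.
move=> hR.
have iotaS n (P : pred nat) : [seq i <- iota 0 n.+1 | P i]
    = [seq i <- iota 0 n | P i] ++ (if P n then [:: n] else [::]).
  by rewrite -addn1 iotaD filter_cat.
(* The old endpoint [size s] becomes inner unless the path was empty; the new endpoint is not
   inner. *)
rewrite /inner size_rcons !iotaS; cbn beta; rewrite !ltnn ltnSn !andbF !cats0 andbT.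
congr (_ ++ _).
apply: eq_in_filter => i; rewrite mem_iota add0n => /= hi.
by rewrite hR // ltnS (ltnW hi) hi.
Qed.

Lemma take_rcons_le (s : seq bool) (c : bool) (i : nat) :
  (i <= size s)%N -> take i (rcons s c) = take i s.
Proof.
by rewrite leq_eqVlt => /orP[/eqP ->|hi];
  rewrite -cats1 ?takel_cat ?take_size_cat ?take_size // ltnW.
Qed.

Lemma descents_rcons (s : seq bool) (c : bool) :
  descents (rcons s c) =
  descents s ++ (if ~~ last true s && c then [:: size s] else [::]).
Proof.
pose R s i := (step_before s i == false) && (step_after s i == true).
rewrite /descents (filter_inner_rcons (R := R)); last first.
  move=> i hi; rewrite /R /step_before /step_after !nth_rcons hi.
  by rewrite (leq_ltn_trans (leq_pred i) hi).
suff -> : (0 < size s)%N && R (rcons s c) (size s) = ~~ last true s && c by [].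
case/lastP: s => [//|s y]; rewrite /R /step_before /step_after size_rcons /= last_rcons.
have -> : nth false (rcons (rcons s y) c) (size s) = y.
  by rewrite nth_rcons size_rcons ltnSn nth_rcons ltnn eqxx.
have -> : nth false (rcons (rcons s y) c) (size s).+1 = c.
  by rewrite nth_rcons size_rcons ltnn eqxx.
by rewrite eqb_id eqbF_neg.
Qed.

Lemma des_rcons (s : seq bool) (c : bool) :
  des (rcons s c) = (des s + (~~ last true s && c))%N.
Proof. by rewrite /des descents_rcons size_cat; case: ifP. Qed.

Lemma maj_rcons (s : seq bool) (c : bool) :
  maj (rcons s c) = (maj s + (~~ last true s && c) * size s)%N.
Proof.
rewrite /maj descents_rcons big_cat; case: ifP => _ /=.
  by rewrite big_seq1 mul1n.
by rewrite big_nil.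
Qed.

Definition final_height (s : seq bool) : int :=
  (count_mem true s)%:Z - (count_mem false s)%:Z.

(** The default of [last] keeps an initial up step from creating a descent, but would make it a
    crossing at the origin for [l = 0]; hence the conjunct [0 < size s]. *)
Lemma size_crossings_rcons (l : int) (s : seq bool) (c : bool) :
  size (crossings l (rcons s c)) =
  (size (crossings l s)
   + [&& (0 < size s)%N, final_height s == l & last true s == c])%N.
Proof.
pose R s i := (height s i == l) && (step_before s i == step_after s i).
rewrite /crossings (filter_inner_rcons (R := R)); last first.
  move=> i hi; rewrite /R /step_before /step_after !nth_rcons hi.
  rewrite (leq_ltn_trans (leq_pred i) hi) /height take_rcons_le //.
  exact: ltnW.
rewrite size_cat; congr (_ + _)%N.
have -> : (0 < size s)%N && R (rcons s c) (size s) =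
  [&& (0 < size s)%N, final_height s == l & last true s == c].
  case/lastP: s => [//|s y]; rewrite size_rcons /= last_rcons /R /height.
  rewrite take_rcons_le ?size_rcons // -(size_rcons s y) take_size.
  rewrite /step_before /step_after size_rcons /=.
  have -> : nth false (rcons (rcons s y) c) (size s) = y.
    by rewrite nth_rcons size_rcons ltnSn nth_rcons ltnn eqxx.
  have -> // : nth false (rcons (rcons s y) c) (size s).+1 = c.
  by rewrite nth_rcons size_rcons ltnn eqxx.
by case: ifP.
Qed.

(** * Enumeration of the paths by their last step *)

Fixpoint words (N : nat) : seq (seq bool) :=
  if N is N'.+1 then
    [seq rcons s true | s <- words N'] ++ [seq rcons s false | s <- words N']
  else [:: [::]].

Lemma mem_words (N : nat) (s : seq bool) : (s \in words N) = (size s == N).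
Proof.
elim: N s => [|N IH] s; first by rewrite /= inE -size_eq0.
rewrite mem_cat; case/lastP: s => [|s c].
  by apply/norP; split; apply/mapP => -[s _]; case: s.
have memr d : (rcons s c \in [seq rcons s' d | s' <- words N])
    = (s \in words N) && (c == d).
  apply/mapP/andP => [[s' hs' /rcons_inj[-> ->]]|[hs /eqP ->]]; first by [].
  by exists s.
by rewrite !memr size_rcons eqSS IH -andb_orr; case: (c); rewrite andbT.
Qed.

Lemma uniq_words (N : nat) : uniq (words N).
Proof.
elim: N => // N IH; rewrite cat_uniq !map_inj_uniq ?IH //=; last 2 first.
- exact: rcons_injl.
- exact: rcons_injl.
rewrite andbT; apply/hasPn => _ /mapP[s _ ->]; apply/mapP => -[s' _].
by move=> /rcons_inj[].
Qed.

Lemma big_tuple_words (V : nmodType) (N : nat) (f : seq bool -> V) (P : pred (seq bool)) :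
  \sum_(s : N.-tuple bool | P s) f s = \sum_(s <- words N | P s) f s.
Proof.
have -> : \sum_(s <- words N | P s) f s =
    \sum_(s <- [seq val s | s <- index_enum (N.-tuple bool)] | P s) f s.
  apply: perm_big; apply: uniq_perm; first exact: uniq_words.
    rewrite map_inj_uniq ?index_enum_uniq //; exact: val_inj.
  move=> s; rewrite mem_words; apply/eqP/mapP => [hs|[u _ ->]]; last exact: size_tuple.
  by exists (Tuple (introT eqP hs)); rewrite ?mem_index_enum.
by rewrite big_map.
Qed.

(** * Generating functions refined by the last step *)

Section PathSums.
Variables (F : fieldType) (x : F) (l : int).

(* [last true s == up]: the empty path counts as ending in an up step, so that
   appending an up step to it creates no descent. *)
Definition path_sum (up : bool) (a b r : nat) (n : int) : F :=
  \sum_(s <- words (a + b) |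
     [&& count_mem true s == a, count_mem false s == b, last true s == up,
         (r <= size (crossings l s))%N & (des s)%:Z == n]) x ^+ maj s.

(** A down step creates no descent. It makes a crossing only after another down step ending at
    height [l]; one crossing fewer is then required before it, and [0.-1 = 0] suits [r = 0]. *)
Lemma path_sum_false (a b r : nat) (n : int) :
  path_sum false a b.+1 r n =
  path_sum true a b r n
    + path_sum false a b (if a%:Z - b%:Z == l then r.-1 else r) n.
Proof.
rewrite /path_sum addnS /= big_cat /= !big_map [X in X + _ = _]big1 ?add0r; last first.
  by move=> s /=; rewrite last_rcons !andbF.
rewrite (bigID (fun s => last true s)) /=; congr (_ + _);
  rewrite big_seq_cond [RHS]big_seq_cond; apply: eq_big => s.
- rewrite -!cats1 !count_cat /= cats1 addn0 addn1 eqSS des_rcons size_crossings_rcons.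
  rewrite last_rcons andbF addn0 /=.
  by case: (last true s); rewrite !(andbF, andbT, addn0).
- by move=> _; rewrite maj_rcons andbF mul0n addn0.
- rewrite -!cats1 !count_cat /= cats1 addn0 addn1 eqSS des_rcons size_crossings_rcons.
  rewrite last_rcons andbF addn0 /= /final_height.
  case: (s \in _) => //=; case: eqP => //= ->; case: eqP => //= ->.
  case/lastP: s => [|s y]; first by rewrite /= !andbF.
  rewrite last_rcons size_rcons addn0 /=.
  case: y; rewrite ?andbF ?andbT //=; case: eqP => _; rewrite /= ?addn0 //.
  by rewrite addn1 -subn1 leq_subLR add1n.
- by move=> _; rewrite maj_rcons andbF mul0n addn0.
Qed.

(** An up step after a down step makes vertex a + b a descent, whence the power of [x] and the shift
    of [n]. The empty path is excluded since for [l = 0] its origin would count as a crossing. *)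
Lemma path_sum_true (a b r : nat) (n : int) : (0 < a + b)%N ->
  path_sum true a.+1 b r n =
  path_sum true a b (if a%:Z - b%:Z == l then r.-1 else r) n
    + x ^+ (a + b) * path_sum false a b r (n - 1).
Proof.
move=> hab; rewrite /path_sum addSn /= big_cat /= !big_map [X in _ + X = _]big1 ?addr0; last first.
  by move=> s /=; rewrite last_rcons !andbF.
rewrite mulr_sumr.
rewrite (bigID (fun s => last true s)) /=; congr (_ + _);
  rewrite big_seq_cond [RHS]big_seq_cond; apply: eq_big => s.
- rewrite -!cats1 !count_cat /= cats1 !addn0 addn1 eqSS des_rcons size_crossings_rcons.
  rewrite last_rcons /= /final_height mem_words.
  case: eqP => //= sz; case: eqP => //= ->; case: eqP => //= ->.
  rewrite sz hab /=; case: (last true s); rewrite ?andbF ?andbT //=.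
  case: eqP => _; rewrite /= ?addn0 //.
  by rewrite addn1 -subn1 leq_subLR add1n.
- by case/andP => _ /andP[_]; rewrite maj_rcons => ->; rewrite mul0n addn0.
- rewrite -!cats1 !count_cat /= cats1 !addn0 addn1 eqSS des_rcons size_crossings_rcons.
  rewrite last_rcons /=; case: (last true s); rewrite ?andbF ?andbT //=.
  rewrite ?andbF ?addn0. do 4 congr (_ && _).
  by lia.
- rewrite mem_words => /andP[/eqP sz /andP[_ /negbTE hs]].
  by rewrite maj_rcons hs mul1n sz exprD mulrC.
Qed.

Lemma path_sum_nil (r : nat) (n : int) :
  path_sum true 0 0 r n = ((n == 0) && (r == 0%N))%:R.
Proof.
rewrite /path_sum big_mkcond big_seq1 /= leqn0 [0 == n]eq_sym andbC.
by case: ifP; rewrite // /maj /= big_nil expr0.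
Qed.

Lemma path_sum_false_b0 (a r : nat) (n : int) : path_sum false a 0 r n = 0.
Proof.
rewrite /path_sum big_seq_cond big1 // => s /andP[_] /and5P[_ + + _ _].
by case/lastP: s => // s c; rewrite last_rcons -cats1 count_cat; case: c; rewrite //= addn1.
Qed.

Lemma path_sum_true_a0 (b r : nat) (n : int) : path_sum true 0 b.+1 r n = 0.
Proof.
rewrite /path_sum big_seq_cond big1 // => s /andP[_] /and5P[+ + + _ _].
by case/lastP: s => // s c; rewrite last_rcons -cats1 count_cat; case: c; rewrite //= addn1.
Qed.

Lemma path_sum_true_b0 (a r : nat) (n : int) :
  path_sum true a 0 r n = ((n == 0) && (r <= (0 < l < a%:Z)%R)%N)%:R.
Proof.
elim: a r => [|a IH] r.
  rewrite path_sum_nil -leqn0 (_ : (0 < l < 0%:Z) = false) //; lia.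
(* A single step is treated apart, as [path_sum_true] does not extend the empty path. *)
case: a IH => [|a] IH.
  rewrite (_ : (0 < l < 1%:Z) = false); last by lia.
  rewrite /path_sum big_mkcond big_cons big_seq1 /= addr0 leqn0 [0 == n]eq_sym andbC.
  by case: ifP; rewrite // /maj /= big_nil expr0.
rewrite path_sum_true // path_sum_false_b0 mulr0 addr0 IH subr0.
congr (_ && _)%:R.
by case: eqP => h; case: r => [|r] //=; lia.
Qed.
End PathSums.

(** * Closed formulas for the path sums *)

Section Crossings.
Variables (F : fieldType) (x : F).
Hypothesis x_neq0 : x != 0.
Hypothesis x_expz_eq1 : forall k : int, (x ^ k == 1) = (k == 0).

(** Away from the line, deleting a final down step leaves an arbitrary path to (a, b - 1), and the
    paths ending in an up step are the rest. On the line the last step decides the side: a down step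
    comes from above, an up step from below, hence the tests [<=] and [<]. *)
Lemma path_sum_formula (l : int) (a b r : nat) (n : int) :
  path_sum x l false a b r n =
    (if l <= a%:Z - b%:Z then above x l r a (b%:Z - 1) n
     else below x l r a (b%:Z - 1) n) /\
  path_sum x l true a b r n =
    (if l < a%:Z - b%:Z then above x l r a b n - above x l r a (b%:Z - 1) n
     else below x l r a b n - below x l r a (b%:Z - 1) n).
Proof.
have [N] := ubnP (a + b); elim: N a b r n => // N IH a b r n hN; split.
  case: b hN => [|b] hN.
    rewrite path_sum_false_b0 sub0r subr0.
    by case: leP => hl; rewrite ?above_neg1 ?below_neg1 //; lia.
  have hab : (a + b < N)%N by lia.
  rewrite path_sum_false (_ : b.+1%:Z - 1 = b); last by lia.
  have [-> _] := IH a b (if a%:Z - b%:Z == l then r.-1 else r) n hab.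
  have [_ ->] := IH a b r n hab.
  case: (leP l (a%:Z - b.+1%:Z)) => hl.
    rewrite (_ : (a%:Z - b%:Z == l) = false); last by lia.
    have hl' : l < a%:Z - b%:Z by lia.
    by rewrite hl' (ltW hl') subrK.
  rewrite (_ : (l < a%:Z - b%:Z) = false); last by lia.
  (* A down step from height [l] replaces [above] at [r.-1] by [below] at [r]; the two agree at (a,
     b - 1), of height [l + 1]. *)
  case: eqP => hl'.
    by rewrite -hl' lexx above_pred ?subrK //; lia.
  by rewrite (_ : (l <= a%:Z - b%:Z) = false) ?subrK //; lia.
case: b hN => [|b] hN.
  rewrite path_sum_true_b0 subr0 sub0r; case: (ltP l a%:Z) => hl.
    by rewrite above_b0 // above_neg1 ?subr0 ?andbT //; exact: ltW.
  by rewrite below_b0 // below_neg1 // subr0 andbF leqn0.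
case: a hN => [|a] hN.
  rewrite path_sum_true_a0; case: ltP => hl.
    by rewrite -above_a0 ?subrr //; lia.
  by rewrite -below_a0 ?subrr //; lia.
have hab : (a + b.+1 < N)%N by lia.
rewrite path_sum_true ?addnS //.
have [-> _] := IH a b.+1 r (n - 1) hab.
have [_ ->] := IH a b.+1 (if a%:Z - b.+1%:Z == l then r.-1 else r) n hab.
rewrite (_ : b.+1%:Z - 1 = b); last by lia.
have rec f (hf : kernel_rec x f a.+1 b.+1) : x ^+ (a + b).+1 * f a b (n - 1) =
    f a.+1 b.+1 n - f a b.+1 n - f a.+1 b n + f a b n.
  have := hf n.
  rewrite (_ : a.+1%:Z - 1 = a); last by lia.
  rewrite (_ : b.+1%:Z - 1 = b); last by lia.
  by rewrite (_ : a.+1%:Z + b.+1%:Z - 1 = (a + b).+1); [move<- | lia].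
case: (ltP l (a.+1%:Z - b.+1%:Z)) => hl; last first.
  rewrite (_ : (a%:Z - b.+1%:Z == l) = false); last by lia.
  rewrite (_ : (l < a%:Z - b.+1%:Z) = false); last by lia.
  rewrite (_ : (l <= a%:Z - b.+1%:Z) = false); last by lia.
  by rewrite (rec (below x l r)); [ring | apply: below_rec => //; lia].
rewrite (_ : l <= a%:Z - b.+1%:Z); last by lia.
rewrite (rec (above x l r)); last by apply: above_rec => //; lia.
case: eqP => hl'; last first.
  by rewrite (_ : l < a%:Z - b.+1%:Z); [ring | lia].
(* An up step from height [l]: the shorter paths ending in an up step carry [below] at [r.-1], the
   new ones [above] at [r]. The second gluing relation matches them. *)
rewrite -hl' ltxx hl'.
have : below x l r.-1 a b.+1 n - above x l r a b.+1 n
       = below x l r.-1 a (b.+1%:Z - 1) n - above x l r a (b.+1%:Z - 1) n.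
  by apply: below_pred_sub_above => //; lia.
rewrite (_ : b.+1%:Z - 1 = b); last by lia.
by move/eqP; rewrite -subr_eq0 => /eqP e; apply: subr0_eq; rewrite -[RHS]e; ring.
Qed.

Definition path_total (l : int) (a b r : nat) (n : int) : F :=
  path_sum x l true a b r n + path_sum x l false a b r n.

Lemma path_total_above (l : int) (a b r : nat) (n : int) : l < a%:Z - b%:Z ->
  path_total l a b r n = above x l r a b n.
Proof.
move=> hl; rewrite /path_total; have [-> ->] := path_sum_formula l a b r n.
by rewrite hl (ltW hl) subrK.
Qed.

Lemma path_total_below (l : int) (a b r : nat) (n : int) : a%:Z - b%:Z < l ->
  path_total l a b r n = below x l r a b n.
Proof.
move=> hl; rewrite /path_total; have [-> ->] := path_sum_formula l a b r n.
by rewrite !ifN ?subrK // -?leNgt -?ltNge // ltW.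
Qed.

Lemma path_total_on (l : int) (a b r : nat) (n : int) : a%:Z - b%:Z = l ->
  path_total l a b r n =
  below x l r a b n - below x l r a (b%:Z - 1) n + above x l r a (b%:Z - 1) n.
Proof.
move=> hl; rewrite /path_total; have [-> ->] := path_sum_formula l a b r n.
by rewrite hl ltxx lexx.
Qed.

(** If [above] does not separate [r] from [r.+1], the second gluing relation at [r.+1] removes the
    [below] terms from the endpoint formula. *)
Lemma path_total_on_above (l : int) (a b r : nat) (n : int) :
  a%:Z - b%:Z = l -> (0 < b)%N -> above x l r.+1 = above x l r ->
  path_total l a b r n = above x l r a b n.
Proof.
move=> hl hb he; rewrite path_total_on //.
have := below_pred_sub_above x_neq0 x_expz_eq1 r.+1 n hl isT hb.
rewrite he /=.
by move/eqP; rewrite -subr_eq0 => /eqP e; apply: subr0_eq; rewrite -[RHS]e; ring.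
Qed.

(** The first gluing relation at [r.+1] applies at (a, b - 1), of height [l + 1], and cancels the
    two correction terms. *)
Lemma path_total_on_below (l : int) (a b r : nat) (n : int) :
  a%:Z - b%:Z = l -> below x l r.+1 = below x l r ->
  path_total l a b r n = below x l r a b n.
Proof.
move=> hl he; rewrite path_total_on //.
suff -> : above x l r a (b%:Z - 1) n = below x l r a (b%:Z - 1) n by rewrite subrK.
by rewrite -he -above_pred //; lia.
Qed.

Definition gauss_ratio (k a : int) : F :=
  if k == a then 1 else (1 - x ^ k) / (1 - x ^ a).

Lemma gauss_ratioE (k a : int) : a != 0 ->
  gauss_ratio k a = (1 - x ^ k) / (1 - x ^ a).
Proof.
move=> ha; rewrite /gauss_ratio; case: eqP => // ->.
by rewrite divff // subr1_expz_neq0.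
Qed.

Lemma gauss_pred (a k : int) : a != 0 ->
  gauss x (a - 1) k = (1 - x ^ (a - k)) * gauss x a k / (1 - x ^ a).
Proof.
by move=> ha; rewrite gauss_pred_mul // mulrAC mulfV ?mul1r // subr1_expz_neq0.
Qed.

Lemma gauss_pred_pred (a k : int) : a != 0 ->
  gauss x (a - 1) (k - 1) = (1 - x ^ k) * gauss x a k / (1 - x ^ a).
Proof.
by move=> ha; rewrite gauss_diag_mul // mulrAC mulfV ?mul1r // subr1_expz_neq0.
Qed.

(** Over [a, n+m] [a, n-m] / (1 - x^a), and up to x^(n^2 + m(m+1)), the [-m] terms give x^(a-n-m) -
    x^(a-2m) and the [m] term gives 1 - x^(a-n-m). *)
Lemma direct_central (a : nat) (m n : int) :
  direct x 0 (- m) a a n - direct x 0 (- m) a (a%:Z - 1) n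
    + direct x 0 m a (a%:Z - 1) n
  = x ^ (n ^+ 2 + m * (m + 1)) * gauss_ratio (a%:Z - 2 * m) a
      * gauss x a (n + m) * gauss x a (n - m).
Proof.
have [->|ha] := posnP a.
  (* For [a = 0] only m = n = 0 contributes, where [gauss_ratio] is 1 by convention. *)
  have [[-> ->]|nm] : (m = 0 /\ n = 0) \/ ((n + m == 0) && (n - m == 0)) = false by lia.
    by rewrite subrK direct0 // /gauss_ratio !gauss0 // !mulr1 expr0z.
  rewrite !direct_out ?subrr ?addr0; try lia.
  have [h|h] : n + m != 0 \/ n - m != 0 by lia.
    by rewrite (@gauss_out _ _ _ (n + m)) ?mulr0 ?mul0r //; lia.
  by rewrite (@gauss_out _ _ _ (n - m)) ?mulr0 //; lia.
have a0 : a%:Z != 0 by lia.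
rewrite /direct -mulrBr -mulrBr gauss_pascal ?a0 // gauss_pred_pred // gauss_pred //.
rewrite gauss_ratioE // opprK.
(* The exponents are split so that [field] sees only independent powers such as [x ^ a], [x ^ n] and
   [x ^ m]. *)
have -> : x ^ (- m * (- m + 0 + 1)) = x ^ (m * (m + 1)) * x ^ (- m) * x ^ (- m).
  by rewrite -!expzD //; congr (x ^ _); ring.
have -> : x ^ (a%:Z - (n - m)) = x ^ a%:Z * x ^ (- n) * x ^ m.
  by rewrite -!expzD //; congr (x ^ _); ring.
have -> : x ^ (a%:Z - (n + m)) = x ^ a%:Z * x ^ (- n) * x ^ (- m).
  by rewrite -!expzD //; congr (x ^ _); ring.
have -> : x ^ (a%:Z - 2 * m) = x ^ a%:Z * x ^ (- m) * x ^ (- m).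
  by rewrite -!expzD //; congr (x ^ _); ring.
have -> : x ^ (n ^+ 2 + m * (m + 1)) = x ^ (n ^+ 2) * x ^ (m * (m + 1)).
  by rewrite -!expzD.
rewrite addr0 !(expzD x_neq0 n) -!invr_expz.
by field; rewrite !expfz_neq0 // subr1_expz_neq0.
Qed.

(** In the same way, over [a, n+m+1] [a, n-m-1] / (1 - x^a), the contributions are x^(a-n+m+1) -
    x^(a+2m+2) and 1 - x^(a-n+m+1). *)
Lemma shifted_central (a : nat) (m n : int) : 0 <= m ->
  shifted x 0 (- m) a a n - shifted x 0 (- m) a (a%:Z - 1) n
    + shifted x 0 (m + 1) a (a%:Z - 1) n
  = x ^ (n ^+ 2 + m * (m + 1)) * gauss_ratio (a%:Z + 2 * (m + 1)) a
      * gauss x a (n + m + 1) * gauss x a (n - m - 1).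
Proof.
move=> m0; have [->|ha] := posnP a.
  rewrite !shifted_out ?subrr ?addr0; try lia.
  (* Both binomials with top 0 survive only at m = -1, n = 0, which [0 <= m] excludes. *)
  have [h|h] : n + m + 1 != 0 \/ n - m - 1 != 0 by lia.
    by rewrite (@gauss_out _ _ _ (n + m + 1)) ?mulr0 ?mul0r //; lia.
  by rewrite (@gauss_out _ _ _ (n - m - 1)) ?mulr0 //; lia.
have a0 : a%:Z != 0 by lia.
rewrite /shifted !subr0 ?addr0 subrK opprK -!mulrBr.
have -> : gauss x (a%:Z + 1) (n - m) - gauss x a (n - m)
    = x ^ (a%:Z + 1 - (n - m)) * gauss x a (n - m - 1).
  have := @gauss_pascal _ _ x_neq0 x_expz_eq1 (a%:Z + 1) (n - m).
  by rewrite addrK => -> //; lia.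
rewrite (_ : n - (m + 1) = n - m - 1); last by ring.
rewrite (_ : n + (m + 1) = n + m + 1); last by ring.
rewrite (gauss_pred (n - m - 1) a0).
rewrite (_ : gauss x (a%:Z - 1) (n + m) =
  (1 - x ^ (n + m + 1)) * gauss x a (n + m + 1) / (1 - x ^ a%:Z)); last first.
  by rewrite -gauss_pred_pred // addrK.
rewrite gauss_ratioE //.
have -> : x ^ (- m * (- m - 1)) = x ^ (m * (m + 1)).
  by congr (x ^ _); ring.
have -> : x ^ ((m + 1) * (m + 1 - 1)) = x ^ (m * (m + 1)).
  by congr (x ^ _); ring.
have -> : x ^ (a%:Z + 1 - (n - m)) = x ^ a%:Z * x ^ 1 * x ^ (- n) * x ^ m.
  by rewrite -!expzD //; congr (x ^ _); ring.
have -> : x ^ (a%:Z - (n - m - 1)) = x ^ a%:Z * x ^ 1 * x ^ (- n) * x ^ m.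
  by rewrite -!expzD //; congr (x ^ _); ring.
have -> : x ^ (a%:Z + 2 * (m + 1)) = x ^ a%:Z * x ^ 1 * x ^ 1 * x ^ m * x ^ m.
  by rewrite -!expzD //; congr (x ^ _); ring.
rewrite [x ^ (n ^+ 2 + _)]expzD // !(expzD x_neq0) expr1z -!invr_expz.
by field; rewrite !expfz_neq0 // subr1_expz_neq0.
Qed.
End Crossings.

(** * Specialization to Q(q) and the coefficients of [G] *)

Lemma q_neq0 : q != 0.
Proof. by rewrite tofrac_eq0 polyX_eq0. Qed.

Lemma q_expz_eq1 (k : int) : (q ^ k == 1) = (k == 0).
Proof.
have posE (n : nat) : (q ^ n%:Z == 1) = (n == 0)%N.
  rewrite -exprnP -tofracXn -tofrac1 tofrac_eq.
  case: n => [|n]; first by rewrite expr0 !eqxx.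
  apply/negbTE/negP => /eqP /(congr1 (size : {poly rat} -> nat)).
  by rewrite size_polyXn size_poly1.
case: k => n; first exact: posE.
by rewrite NegzE -invr_expz invr_eq1 posE oppr_eq0.
Qed.

Lemma des_le (s : seq bool) : (des s < (size s).+2)%N.
Proof. by rewrite /des size_filter ltnS (leq_trans (count_size _ _)) ?size_iota. Qed.

Lemma path_total_words (l : int) (a b r : nat) (n : int) :
  path_total q l a b r n =
  \sum_(s <- words (a + b) |
     [&& count_mem true s == a, count_mem false s == b,
         (r <= size (crossings l s))%N & (des s)%:Z == n]) q ^+ maj s.
Proof.
rewrite /path_total /path_sum [RHS](bigID (fun s => last true s)) /=.
congr (_ + _); apply: eq_bigl => s;
  by case: (last true s); rewrite ?andbT ?andbF.
Qed.

Lemma path_total_large (l : int) (a b r n : nat) : (a + b + 2 <= n)%N ->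
  path_total q l a b r n = 0.
Proof.
move=> hn; rewrite path_total_words big_seq_cond big1 // => s.
rewrite mem_words => /andP[/eqP hs /and4P[_ _ _ /eqP[hd]]].
by have := des_le s; lia.
Qed.

Lemma G_expand (a b r : nat) (l : int) :
  G a b r l = \sum_(0 <= n < a + b + 2) path_total q l a b r n *: t ^+ n.
Proof.
pose P s := [&& count_mem true s == a, count_mem false s == b
  & (r <= size (crossings l s))%N].
have -> : G a b r l = \sum_(s <- words (a + b) | P s) q ^+ maj s *: t ^+ des s.
  rewrite -(big_tuple_words _ (fun s => q ^+ maj s *: t ^+ des s)); apply: eq_bigl => s.
  by rewrite !inE /P -andbA.
transitivity (\sum_(s <- words (a + b) | P s)
    \sum_(0 <= n < a + b + 2 | des s == n) q ^+ maj s *: t ^+ n).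
  rewrite big_seq_cond [RHS]big_seq_cond; apply: eq_bigr => s.
  rewrite mem_words => /andP[/eqP hs _].
  rewrite (big_rem (des s)) /= ?eqxx; last first.
    by rewrite mem_index_iota /=; have := des_le s; lia.
  rewrite big_seq_cond big1 ?addr0 // => i /andP[hi /eqP di].
  by move: hi; rewrite -di mem_rem_uniq ?iota_uniq // inE eqxx.
under eq_bigr do rewrite big_mkcond.
rewrite exchange_big; apply: eq_bigr => n _ /=.
rewrite path_total_words scaler_suml -big_mkcondr; apply: eq_bigl => s.
by rewrite /P -!andbA.
Qed.

(** The sum over all n has finite support: [des] never reaches a + b + 2, so the coefficients vanish
    from there on. *)
Lemma G_coef (a b r : nat) (l : int) (c : nat -> Qq) :
  (forall n : nat, path_total q l a b r n = c n) ->
  G a b r l = \sum_(n \in [set: nat]%classic) c n *: t ^+ n.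
Proof.
move=> hc; rewrite G_expand (fsbigE (index_iota 0 (a + b + 2))) ?iota_uniq //.
  by rewrite [RHS]big_mkcond; apply: eq_bigr => n _; rewrite hc in_setT.
move=> n _; rewrite mem_index_iota /= -leqNgt => hn.
by rewrite -hc path_total_large ?scale0r.
Qed.

Lemma eq_G (a b r r' : nat) (l : int) :
  (forall n : nat, path_total q l a b r n = path_total q l a b r' n) ->
  G a b r l = G a b r' l.
Proof. by move=> hr; rewrite !G_expand; apply: eq_bigr => n _; rewrite hr. Qed.

Lemma directE (l s a b n e i j : int) :
  e = n ^+ 2 + s * (s + l + 1) -> i = n - s -> j = n + s ->
  direct q l s a b n = q ^ e * qbinom a i * qbinom b j.
Proof.
by move=> -> -> ->; rewrite /direct !mulrA -expzD ?q_neq0 // [s * _ + _]addrC.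
Qed.

Lemma shiftedE (l s a b n e i j A B : int) :
  e = n ^+ 2 + s * (s - l - 1) -> A = a - l - 1 -> i = n - s ->
  B = b + l + 1 -> j = n + s ->
  shifted q l s a b n = q ^ e * qbinom A i * qbinom B j.
Proof.
by move=> -> -> -> -> ->; rewrite /shifted !mulrA -expzD ?q_neq0 // [s * _ + _]addrC.
Qed.

(** * The nine positions of the endpoint and the line *)

Theorem theorem2p1 (a b m : nat) (l : int) :
  (* I *)
  (0 < l -> l < a%:Z - b%:Z ->
       G a b (2 * m + 1)%N l = G a b (2 * m)%N l /\
       G a b (2 * m)%N l =
         \sum_(n \in [set: nat]%classic)
           (q ^ (n%:Z ^+ 2 + m%:Z * (m%:Z + l + 1)) * qbinom a%:Z (n%:Z - m%:Z)
              * qbinom b%:Z (n%:Z + m%:Z)) *: t ^+ n) /\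
  (* II *)
  (0 > l -> l > a%:Z - b%:Z ->
       G a b (2 * m + 1)%N l = G a b (2 * m)%N l /\
       G a b (2 * m)%N l =
         \sum_(n \in [set: nat]%classic)
           (q ^ (n%:Z ^+ 2 + m%:Z * (m%:Z - l - 1)) * qbinom a%:Z (n%:Z + m%:Z)
              * qbinom b%:Z (n%:Z - m%:Z)) *: t ^+ n) /\
  (* III *)
  (0 > l -> l < a%:Z - b%:Z ->
       G a b (2 * m + 2)%N l = G a b (2 * m + 1)%N l /\
       G a b (2 * m + 1)%N l =
         \sum_(n \in [set: nat]%classic)
           (q ^ (n%:Z ^+ 2 + (m%:Z + 1) * (m%:Z - l)) * qbinom (a%:Z - l - 1) (n%:Z - m%:Z - 1)
              * qbinom (b%:Z + l + 1) (n%:Z + m%:Z + 1)) *: t ^+ n) /\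
  (* IV *)
  (0 < l -> l > a%:Z - b%:Z ->
       G a b (2 * m + 2)%N l = G a b (2 * m + 1)%N l /\
       G a b (2 * m + 1)%N l =
         \sum_(n \in [set: nat]%classic)
           (q ^ (n%:Z ^+ 2 + m%:Z * (m%:Z + l + 1)) * qbinom (a%:Z - l - 1) (n%:Z + m%:Z)
              * qbinom (b%:Z + l + 1) (n%:Z - m%:Z)) *: t ^+ n) /\
  (* V *)
  (0 = l -> l < a%:Z - b%:Z ->
       G a b (2 * m)%N l =
         \sum_(n \in [set: nat]%classic)
           (q ^ (n%:Z ^+ 2 + m%:Z * (m%:Z + 1)) * qbinom a%:Z (n%:Z - m%:Z)
              * qbinom b%:Z (n%:Z + m%:Z)) *: t ^+ n /\
       G a b (2 * m + 1)%N l =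
         \sum_(n \in [set: nat]%classic)
           (q ^ (n%:Z ^+ 2 + m%:Z * (m%:Z + 1)) * qbinom (a%:Z - 1) (n%:Z - m%:Z - 1)
              * qbinom (b%:Z + 1) (n%:Z + m%:Z + 1)) *: t ^+ n) /\
  (* VI *)
  (0 = l -> l > a%:Z - b%:Z ->
       G a b (2 * m)%N l =
         \sum_(n \in [set: nat]%classic)
           (q ^ (n%:Z ^+ 2 + m%:Z * (m%:Z - 1)) * qbinom a%:Z (n%:Z + m%:Z)
              * qbinom b%:Z (n%:Z - m%:Z)) *: t ^+ n /\
       G a b (2 * m + 1)%N l =
         \sum_(n \in [set: nat]%classic)
           (q ^ (n%:Z ^+ 2 + m%:Z * (m%:Z + 1)) * qbinom (a%:Z - 1) (n%:Z + m%:Z)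
              * qbinom (b%:Z + 1) (n%:Z - m%:Z)) *: t ^+ n) /\
  (* VII *)
  (0 < l -> l = a%:Z - b%:Z ->
       G a b (2 * m)%N l =
         \sum_(n \in [set: nat]%classic)
           (q ^ (n%:Z ^+ 2 + m%:Z * (m%:Z + l + 1)) * qbinom a%:Z (n%:Z - m%:Z)
              * qbinom b%:Z (n%:Z + m%:Z)) *: t ^+ n /\
       G a b (2 * m + 1)%N l =
         \sum_(n \in [set: nat]%classic)
           (q ^ (n%:Z ^+ 2 + m%:Z * (m%:Z + l + 1)) * qbinom (a%:Z + 1) (n%:Z - m%:Z)
              * qbinom (b%:Z - 1) (n%:Z + m%:Z)) *: t ^+ n) /\
  (* VIII *)
  (0 > l -> l = a%:Z - b%:Z ->
       G a b (2 * m)%N l =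
         \sum_(n \in [set: nat]%classic)
           (q ^ (n%:Z ^+ 2 + m%:Z * (m%:Z - l - 1)) * qbinom a%:Z (n%:Z + m%:Z)
              * qbinom b%:Z (n%:Z - m%:Z)) *: t ^+ n /\
       G a b (2 * m + 1)%N l =
         \sum_(n \in [set: nat]%classic)
           (q ^ (n%:Z ^+ 2 + (m%:Z + 1) * (m%:Z - l)) * qbinom (a%:Z + 1) (n%:Z + m%:Z + 1)
              * qbinom (b%:Z - 1) (n%:Z - m%:Z - 1)) *: t ^+ n) /\
  (* IX *)
  (0 = l -> l = a%:Z - b%:Z ->
       G a b (2 * m)%N l =
         \sum_(n \in [set: nat]%classic)
           (q ^ (n%:Z ^+ 2 + m%:Z * (m%:Z + 1)) * qratio (a%:Z - 2 * m%:Z) a%:Z * qbinom a%:Z (n%:Z + m%:Z)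
              * qbinom a%:Z (n%:Z - m%:Z)) *: t ^+ n /\
       G a b (2 * m + 1)%N l =
         \sum_(n \in [set: nat]%classic)
           (q ^ (n%:Z ^+ 2 + m%:Z * (m%:Z + 1)) * qratio (a%:Z + 2 * (m%:Z + 1)) a%:Z * qbinom a%:Z (n%:Z + m%:Z + 1)
              * qbinom a%:Z (n%:Z - m%:Z - 1)) *: t ^+ n).
Proof.
(* Cases I, III, V are read off [above], cases II, IV, VI off [below], and VII to IX off the
   endpoint formula. *)
have half0 : ((2 * m)./2 = m)%N by lia.
have half1 : ((2 * m + 1)./2 = m)%N by lia.
have half0' : ((2 * m).-1)./2 = m.-1 by lia.
have half1' : ((2 * m + 1).-1)./2 = m by lia.
have half2' : ((2 * m + 2).-1)./2 = m by lia.
have uphalf1 : uphalf (2 * m + 1) = m.+1 by lia.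
have uphalf2 : uphalf (2 * m + 2) = m.+1 by lia.
have odd0 : odd (2 * m) = false by lia.
have odd1 : odd (2 * m + 1) by lia.
have nz1 : (2 * m + 1 == 0)%N = false by lia.
have nz2 : (2 * m + 2 == 0)%N = false by lia.
have S0 : (2 * m).+1 = (2 * m + 1)%N by lia.
have S1 : (2 * m + 1).+1 = (2 * m + 2)%N by lia.
split=> [l0 hl|].
  have tot r (n : nat) : path_total q l a b r n = direct q l r./2 a b n.
    by rewrite path_total_above ?q_neq0 //; [rewrite /above l0 | exact: q_expz_eq1].
  split; first by apply: eq_G => n; rewrite !tot half0 half1.
  by apply: G_coef => n; rewrite tot half0; apply: directE; lia.
split=> [l0 hl|].
  have tot r (n : nat) : path_total q l a b r n = direct q l (- r./2%:Z) a b n.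
    rewrite path_total_below ?q_neq0 //; last exact: q_expz_eq1.
    by rewrite /below ltNge (ltW l0) /= l0.
  split; first by apply: eq_G => n; rewrite !tot half0 half1.
  by apply: G_coef => n; rewrite tot half0; apply: directE; lia.
split=> [l0 hl|].
  have tot r (n : nat) : r != 0%N -> path_total q l a b r n = shifted q l (uphalf r) a b n.
    move=> /negbTE hr; rewrite path_total_above ?q_neq0 //; last exact: q_expz_eq1.
    by rewrite /above ltNge (ltW l0) /= l0 hr.
  split; first by apply: eq_G => n; rewrite !tot ?nz1 ?nz2 // uphalf1 uphalf2.
  by apply: G_coef => n; rewrite tot ?nz1 // uphalf1; apply: shiftedE; lia.
split=> [l0 hl|].
  have tot r (n : nat) : r != 0%N -> path_total q l a b r n = shifted q l (- (r.-1)./2%:Z) a b n.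
    move=> /negbTE hr; rewrite path_total_below ?q_neq0 //; last exact: q_expz_eq1.
    by rewrite /below l0 hr.
  split; first by apply: eq_G => n; rewrite !tot ?nz1 ?nz2 // half1' half2'.
  by apply: G_coef => n; rewrite tot ?nz1 // half1'; apply: shiftedE; lia.
split=> [l0 hl|].
  rewrite -l0 in hl *.
  split; apply: G_coef => n; rewrite path_total_above ?q_neq0 //; try exact: q_expz_eq1.
    by rewrite /above ltxx odd0 half0; apply: directE; lia.
  by rewrite /above ltxx odd1 half1; apply: shiftedE; lia.
split=> [l0 hl|].
  rewrite -l0 in hl *.
  split; apply: G_coef => n; rewrite path_total_below ?q_neq0 //; try exact: q_expz_eq1.
    by rewrite /below ltxx odd0 half0; apply: directE; lia.
  by rewrite /below ltxx odd1 half1; apply: shiftedE; lia.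
split=> [l0 hl|].
  (* For [0 < l] the formula that agrees at r and r + 1 is [above] for even r and [below] for odd r;
     for [l < 0], in the next case, the roles are exchanged. *)
  split; apply: G_coef => n.
    have -> : path_total q l a b (2 * m)%N n = direct q l m a b n.
      (* The second gluing relation needs [0 < b]. For [b = 0] all terms vanish if m > 0, and all
         are values of [direct l 0] if m = 0. *)
      have [b0|b_gt0] := posnP b.
        rewrite path_total_on ?q_neq0 //; last exact: q_expz_eq1.
        rewrite /above /below l0 half0 half0'.
        have [m0|m_gt0] := posnP m; first by rewrite m0 /= subrK.
        rewrite (_ : (2 * m == 0)%N = false); last by lia.
        rewrite !shifted_out ?subr0 ?add0r; try lia.
        by rewrite !direct_out //; lia.
      rewrite path_total_on_above ?q_neq0 //; try exact: q_expz_eq1.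
        by rewrite /above l0 half0.
      by rewrite /above l0 S0 half0 half1.
    by apply: directE; lia.
  rewrite path_total_on_below ?q_neq0 //; try exact: q_expz_eq1.
    (* On the line the tops of [shifted] are [b - 1] and [a + 1], in the order opposite to the
       statement. *)
    by rewrite /below l0 nz1 half1' mulrAC; apply: shiftedE; lia.
  by rewrite /below l0 S1 nz1 nz2 half1' half2'.
split=> [l0 hl|].
  have l0' : (0 < l) = false by lia.
  split; apply: G_coef => n.
    rewrite path_total_on_below ?q_neq0 //; try exact: q_expz_eq1.
      by rewrite /below l0' l0 half0; apply: directE; lia.
    by rewrite /below l0' l0 S0 half0 half1.
  rewrite path_total_on_above ?q_neq0 //; try exact: q_expz_eq1; last first.
  - by rewrite /above l0' l0 S1 nz1 nz2 uphalf1 uphalf2.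
  - by lia.
  by rewrite /above l0' l0 nz1 uphalf1 mulrAC; apply: shiftedE; lia.
move=> l0 hl; rewrite -l0 in hl *.
have ab : b = a by lia.
rewrite {b}ab in hl *.
split; apply: G_coef => n; rewrite path_total_on ?q_neq0 //; try exact: q_expz_eq1.
  rewrite /above /below ltxx odd0 half0.
  exact: direct_central q_neq0 q_expz_eq1 _ _ _.
rewrite /above /below ltxx odd1 half1.
by apply: (shifted_central q_neq0 q_expz_eq1).
Qed.
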